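(* Let $G$ be a directed graph (not necessarily planar or embedded) with generic non-negative dart weights, and let $uv$ be an edge of $G$. For $\lambda\in[0,1]$ let $T_\lambda$ be the shortest-path tree whose source $s$ is the point at position $\lambda$ on $uv$, and put $T_u=T_0$ and $T_v=T_1$, regarded as sets of directed edges. As $\lambda$ increases continuously from $0$ to $1$, the number of pivots in $T_\lambda$ is equal to the number of edges in $T_u\setminus T_v$.
   Context: The directed edges of $G$ are called darts; $u\to v$ is a dart with tail $u$ and head $v$. Whenever $G$ contains a dart it also contains its reversal; the edge $uv$ is the pair $\{u\to v,v\to u\}$, and the two darts may have different finite non-negative weights $w$. For the edge $uv$ and $\lambda\in[0,1]$, the edge $uv$ is subdivided by a new vertex $s$ with weights $w_\lambda(u\to s)=\lambda w(u\to v)$, $w_\lambda(s\to v)=(1-\lambda)w(u\to v)$, $w_\lambda(s\to u)=\lambda w(v\to u)$, $w_\lambda(v\to s)=(1-\lambda)w(v\to u)$, and all other weights are unchanged. $T_\lambda$ is the shortest-path tree rooted at $s$ in this subdivided graph with respect to $w_\lambda$, with darts directed away from $s$; $\mathrm{dist}_\lambda$ is the distance from $s$, and $\mathrm{slack}_\lambda(x\to y)=\mathrm{dist}_\lambda(x)+w_\lambda(x\to y)-\mathrm{dist}_\lambda(y)$. The trees $T_0$ and $T_1$ are identified with the shortest-path trees rooted at $u$ and at $v$, respectively. At a critical value of $\lambda$ the slack of some dart $y\to z$ not in $T_\lambda$ (with $z\neq s$) decreases to zero, so that it is just about to become tense (have negative slack); then a pivot occurs: $y\to z$ enters the tree and replaces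 the tree dart $x\to z$ currently entering $z$. The weights are generic if all vertex-to-vertex shortest paths in $G$ are unique and exactly one dart becomes tense at each critical value. *)

(* Defs.v *)
From HB Require Import structures.
From mathcomp Require Import all_boot all_order all_algebra.
From mathcomp Require Import all_classical reals.

Set Implicit Arguments.
Unset Strict Implicit.
Unset Printing Implicit Defensive.
Import Order.TTheory GRing.Theory Num.Theory.
Local Open Scope ring_scope.

Section Walks.
Variables (R : realType) (W : finType) (adj : rel W) (w : W -> W -> R).

(* A walk is given by its first vertex x and the sequence p of its other
   vertices, as for [path]; it ends at [last x p]. *)
Definition walk_weight (x : W) (p : seq W) : R :=
  \sum_(d <- zip (belast x p) p) w d.1 d.2.

Definition shortest (x : W) (p : seq W) : Prop :=
  path adj x p /\
  forall q, path adj x q -> last x q = last x p ->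
    walk_weight x p <= walk_weight x q.

(* Uniqueness is among walks, so in particular it rules out directed cycles of
   weight 0. *)
Definition unique_shortest_paths : Prop :=
  forall x p q, shortest x p -> shortest x q -> last x p = last x q -> p = q.

(* If y is not reachable from x this is [inf set0], i.e. 0; see [slack]. *)
Definition dist (x y : W) : R :=
  inf (fun r : R =>
    exists2 p, path adj x p /\ last x p = y & r = walk_weight x p).

Definition rel_of (T : {set W * W}) : rel W := [rel x y | (x, y) \in T].

(* T spans the vertices reachable from r, is an arborescence (exactly one
   directed walk in T from r to each of these vertices, which for r itself
   excludes cycles), and has only shortest walks from r. *)
Definition is_spt (r : W) (T : {set W * W}) : Prop :=
  [/\ forall d, d \in T -> adj d.1 d.2 /\ connect (rel_of T) r d.1,
      forall z, connect adj r z ->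
        exists! p, path (rel_of T) r p /\ last r p = z
    & forall p, path (rel_of T) r p -> shortest r p].

End Walks.

Section Subdivision.
Variables (R : realType) (V : finType) (adj : rel V) (w : V -> V -> R).
Variables (u v : V).

(* The vertex [Some x] is the vertex x of G, and [None] is the new vertex s. *)
Definition dart : finType := (option V * option V)%type.

Definition sub_adj : rel (option V) := fun x y =>
  match x, y with
  | Some a, Some b => adj a b && ((a, b) \notin [:: (u, v); (v, u)])
  | None, Some b => b \in [:: u; v]
  | Some a, None => a \in [:: u; v]
  | None, None => false
  end.

Definition sub_w (l : R) (x y : option V) : R :=
  match x, y with
  | Some a, Some b => w a b
  | None, Some b => if b == u then l * w v u else (1 - l) * w u v
  | Some a, None => if a == u then l * w u v else (1 - l) * w v u
  | None, None => 0
  end.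

Definition spt_at (l : R) (T : {set dart}) : Prop :=
  is_spt sub_adj (sub_w l) None T.

Definition dist_at (l : R) (x : option V) : R :=
  dist sub_adj (sub_w l) None x.

(* When [adj] is symmetric a dart has either both or none of its ends reachable
   from s; in the latter case its slack is constant, equal to its weight in G,
   and so it never satisfies [becomes_tense]. *)
Definition slack (l : R) (d : dart) : R :=
  dist_at l d.1 + sub_w l d.1 d.2 - dist_at l d.2.

Definition becomes_tense (l : R) (d : dart) : Prop :=
  [/\ l <= 1, sub_adj d.1 d.2, d.2 <> None
    & exists eps : R,
      [/\ 0 < eps <= l,
          forall (a : R) (T : {set dart}), l - eps <= a < l ->
            spt_at a T -> d \notin T,
          forall a b : R, l - eps <= a -> a < b -> b <= l ->
            slack b d < slack a d
        & slack l d = 0]].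

Definition critical (l : R) : Prop := exists d, becomes_tense l d.

Definition generic : Prop :=
  unique_shortest_paths adj w /\
  forall l, critical l -> exists! d, becomes_tense l d.

(* T is the shortest-path tree just before l, and swapping out [dout] for [din]
   gives the one just after l; at l itself both are shortest-path trees. *)
Definition pivot (l : R) (din dout : dart) : Prop :=
  becomes_tense l din /\
  exists (eps : R) (T : {set dart}),
    [/\ 0 < eps <= l,
        dout \in T /\ dout.2 = din.2,
        forall a : R, l - eps <= a <= l -> spt_at a T
      & forall a : R, l <= a <= l + eps -> a <= 1 ->
          spt_at a (din |: T :\ dout)].

Definition pivots : classical_sets.set (R * (dart * dart)) :=
  fun q => pivot q.1 q.2.1 q.2.2.

End Subdivision.

(* Main.v *)
Require Import Defs.
From HB Require Import structures.
From mathcomp Require Import all_boot all_order all_algebra.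
From mathcomp Require Import all_classical reals.
From mathcomp Require Import finmap ring lra.

Set Implicit Arguments.
Unset Strict Implicit.
Unset Printing Implicit Defensive.
Import Order.TTheory GRing.Theory Num.Theory.
Local Open Scope ring_scope.

(* Write A = w(v->u), B = w(u->v), and let d_u, d_v be the distances in G from
   u and v.  The distance from s to z at position l is
   min (l A + d_u(z), (1 - l) B + d_v(z)), and A + B > 0 because zero-weight
   cycles would break uniqueness; so z is reached through u up to the position
   c(z) = (B + d_v(z) - d_u(z)) / (A + B) in [0, 1] and through v after it, and
   its parent is p0(z) before c(z) and p1(z) after it.  The triangle inequality
   makes c monotone along both trees, whence the darts tight at l are exactly
   the (p0(z), z) with l <= c(z) and the (p1(z), z) with c(z) <= l.  Therefore
   the darts that become tense are the (p1(z), z) with p0(z) <> p1(z), at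
   l = c(z); genericity makes c injective on these z, so each gives one pivot,
   and each accounts for one dart (p0(z), z) of T_u \ T_v. *)

(** * Shortest walks and distances for non-negative weights *)

Section WalkWeight.
Variables (R : realType) (W : finType) (adj : rel W) (w : W -> W -> R).

Lemma walk_weight_nil x : walk_weight w x [::] = 0.
Proof. by rewrite /walk_weight big_nil. Qed.

Lemma walk_weight_cons x y p :
  walk_weight w x (y :: p) = w x y + walk_weight w y p.
Proof. by rewrite /walk_weight /= big_cons. Qed.

Lemma walk_weight_cat x p q :
  walk_weight w x (p ++ q) = walk_weight w x p + walk_weight w (last x p) q.
Proof.
elim: p x => [|y p IHp] x /=; first by rewrite walk_weight_nil add0r.
by rewrite !walk_weight_cons IHp addrA.
Qed.

Lemma walk_weight_rcons x p z :
  walk_weight w x (rcons p z) = walk_weight w x p + w (last x p) z.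
Proof.
by rewrite -cats1 walk_weight_cat walk_weight_cons walk_weight_nil addr0.
Qed.

Hypothesis w_ge0 : forall x y, adj x y -> 0 <= w x y.

Lemma walk_weight_ge0 x p : path adj x p -> 0 <= walk_weight w x p.
Proof.
elim: p x => [|y p IHp] x /=; first by rewrite walk_weight_nil.
by case/andP=> xy yp; rewrite walk_weight_cons addr_ge0 ?w_ge0 ?IHp.
Qed.

(** When [x] recurs in the simplified tail, everything before the recurrence is dropped;
    non-negative weights make this free. *)
Lemma simple_walk_le x p : path adj x p ->
  exists q, [/\ path adj x q, last x q = last x p, uniq (x :: q)
              & walk_weight w x q <= walk_weight w x p].
Proof.
elim: p x => [|y p IHp] x /=; first by exists [::].
case/andP=> xy /IHp[q [yq lq uq wq]]; have [xq|xNq] := boolP (x \in y :: q).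
- case/splitPl: xq yq lq uq wq => q1 q2 lq1.
  rewrite cat_path last_cat lq1 => /andP[yq1 xq2] lq2 uq wq.
  exists q2; split=> //.
    move: uq; rewrite -cat_cons cat_uniq => /and3P[_ /hasPn q12 uq2].
    rewrite /= uq2 andbT; apply: contraTN (mem_last y q1); rewrite lq1.
    exact: q12.
  rewrite walk_weight_cons; apply: ler_wpDl; first exact: w_ge0.
  by apply: le_trans wq; rewrite walk_weight_cat lq1 lerDr walk_weight_ge0.
- exists (y :: q); split=> //=; first by rewrite xy.
    by move: uq xNq => /= -> ->.
  by rewrite !walk_weight_cons lerD2l.
Qed.

(** Simple walks fit in sequences of length at most [#|W|], a finite type, so a minimum there is a
    minimum over all walks. *)
Lemma shortest_exists x z : connect adj x z ->
  exists2 p, shortest adj w x p & last x p = z.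
Proof.
case/connectP=> p0 xp0 ->{z}.
have small q : uniq (x :: q) -> (size q <= #|W|)%N.
  by move=> /card_uniqP /= szq; rewrite ltnW // -szq max_card.
have [p [xp lp up _]] := simple_walk_le xp0.
pose P (b : #|W|.-bseq W) := path adj x b && (last x b == last x p0).
have Pp : P (Bseq (small p up)) by rewrite /P /= xp lp eqxx.
case: (arg_minP (fun b : #|W|.-bseq W => walk_weight w x b) Pp) => b.
case/andP=> xb /eqP lb min_b; exists b => //; split=> // q xq lq.
have [q' [xq' lq' uq' wq']] := simple_walk_le xq.
apply: le_trans wq'; apply: (min_b (Bseq (small q' uq'))).
by rewrite /P /= xq' lq' lq lb eqxx.
Qed.

Lemma shortest_dist x p :
  shortest adj w x p -> dist adj w x (last x p) = walk_weight w x p.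
Proof.
case=> xp min_p; apply/eqP; rewrite eq_le; apply/andP; split.
  apply: ge_inf; last by exists p.
  by exists 0 => _ [q [xq _] ->]; apply: walk_weight_ge0.
apply: lb_le_inf; first by exists (walk_weight w x p), p.
by move=> _ [q [xq lq] ->]; apply: min_p.
Qed.

Lemma dist_le x p :
  path adj x p -> dist adj w x (last x p) <= walk_weight w x p.
Proof.
move=> xp; apply: ge_inf; last by exists p.
by exists 0 => _ [q [xq _] ->]; apply: walk_weight_ge0.
Qed.

Lemma dist_unreachable x z : ~~ connect adj x z -> dist adj w x z = 0.
Proof.
move=> xNz; rewrite /dist -[RHS](@inf0 R); congr inf.
apply/seteqP; split=> // r [p [xp lp] _]; case/negP: xNz.
by apply/connectP; exists p.
Qed.

Lemma shortest_le_dist x p : path adj x p ->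
  walk_weight w x p <= dist adj w x (last x p) -> shortest adj w x p.
Proof.
by move=> xp wp; split=> // q xq lq; rewrite (le_trans wp) // -lq dist_le.
Qed.

Lemma dist_ge0 x z : 0 <= dist adj w x z.
Proof.
have [/shortest_exists[p sp <-]|/dist_unreachable-> //] :=
  boolP (connect adj x z).
by rewrite (shortest_dist sp); case: sp => xp _; apply: walk_weight_ge0.
Qed.

Lemma dist_refl x : dist adj w x x = 0.
Proof.
have /= := @dist_le x [::] isT; rewrite walk_weight_nil => dx.
by apply/eqP; rewrite eq_le dx dist_ge0.
Qed.

Lemma dist_step x y z : connect adj x y -> adj y z ->
  dist adj w x z <= dist adj w x y + w y z.
Proof.
case/shortest_exists=> p sp <- yz; rewrite (shortest_dist sp).
rewrite -walk_weight_rcons -[in X in X <= _](last_rcons x p z).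
by apply: dist_le; rewrite rcons_path yz andbT; case: sp.
Qed.

Lemma dist_head x y z : adj x y -> connect adj y z ->
  dist adj w x z <= w x y + dist adj w y z.
Proof.
move=> xy /shortest_exists[p sp <-]; rewrite (shortest_dist sp).
rewrite -walk_weight_cons; apply: (@dist_le x (y :: p)) => /=.
by rewrite xy; case: sp.
Qed.

(** A boolean form, through distances, of the condition that some shortest walk from [r] to [z] ends
    with the dart from [x]. *)
Definition tight_pred r x z :=
  [&& connect adj r x, adj x z & dist adj w r z == dist adj w r x + w x z].

Lemma tight_pred_exists r z : connect adj r z -> z != r ->
  exists x, tight_pred r x z.
Proof.
move=> /shortest_exists[p sp <-]; case/lastP: p sp => [|p y] sp.
  by rewrite eqxx.
rewrite last_rcons => _; exists (last r p).
have [] := sp; rewrite rcons_path => /andP[rp py] _.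
have rp' : connect adj r (last r p) by apply/connectP; exists p.
apply/and3P; split=> //; rewrite eq_le dist_step //=.
move: (shortest_dist sp); rewrite last_rcons walk_weight_rcons => ->.
by rewrite lerD2r dist_le.
Qed.

(** * Consequences of the uniqueness of shortest walks *)

Hypothesis w_unique : unique_shortest_paths adj w.

Lemma tight_shortest r x z : tight_pred r x z ->
  exists2 p, shortest adj w r (rcons p z) & last r p = x.
Proof.
case/and3P=> /shortest_exists[p sp <-] xz /eqP dz; exists p => //.
case: (sp) => rp _; apply: shortest_le_dist; first by rewrite rcons_path rp.
by rewrite walk_weight_rcons last_rcons dz (shortest_dist sp).
Qed.

Lemma tight_pred_uniq r x y z : tight_pred r x z -> tight_pred r y z -> x = y.
Proof.
move=> /tight_shortest[p sp <-] /tight_shortest[q sq <-].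
by have /rcons_inj[->] := w_unique sp sq ltac:(by rewrite !last_rcons).
Qed.

(** The empty walk is shortest from [x] to [x], and a closed walk of weight 0 would tie with it. *)
Lemma closed_walk_eq0 x p : path adj x p -> last x p = x ->
  walk_weight w x p = 0 -> p = [::].
Proof.
move=> xp lp wp; apply: (@w_unique x) => //; split=> // q xq _.
  by rewrite wp walk_weight_ge0.
by rewrite walk_weight_nil walk_weight_ge0.
Qed.

(** A tight dart into the root would complete a non-empty closed walk of weight 0. *)
Lemma tight_pred_root r x : tight_pred r x r = false.
Proof.
apply/negP=> /tight_shortest[p sp _]; case: (sp) => rp _.
have /closed_walk_eq0 := rp; rewrite last_rcons -(shortest_dist sp).
by rewrite last_rcons dist_refl => /(_ erefl erefl); case: p {sp rp}.
Qed.

Lemma dist_cycle_gt0 x y : adj x y -> connect adj y x ->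
  0 < w x y + dist adj w y x.
Proof.
move=> xy cyx; have [p sp lp] := shortest_exists cyx.
rewrite lt_def addr_ge0 ?w_ge0 ?dist_ge0 // andbT; apply/eqP.
rewrite -{2}lp (shortest_dist sp) -walk_weight_cons.
have xyp : path adj x (y :: p) by case: sp => yp _; rewrite /= xy.
by move=> w0; have := closed_walk_eq0 xyp lp w0.
Qed.

End WalkWeight.

(** * Shortest-path trees from a potential and a parent function *)

Section TightTree.
Variables (R : realType) (W : finType) (adj : rel W) (w : W -> W -> R).
Variables (r : W) (S : pred W) (D : W -> R) (par : W -> W).

(* A certificate for shortest paths from r: the potential D bounds all walks
   from below and is attained along the parents.  The tight parents may have
   weight 0, so acyclicity is a separate condition. *)
Record tight_parents : Prop := TightParents {
  tp_root : S r;
  tp_closed : forall x z, S x -> adj x z -> S z;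
  tp_potential_root : D r = 0;
  tp_potential : forall x z, S x -> adj x z -> D z <= D x + w x z;
  tp_parent_root : par r = r;
  tp_parent : forall z, S z -> z != r ->
    [/\ S (par z), adj (par z) z & D z = D (par z) + w (par z) z];
  tp_acyclic : forall z n,
    S z -> z != r -> (0 < n)%N -> iter n par z <> z
}.

Hypothesis par_ok : tight_parents.

Let Sr := tp_root par_ok.
Let S_closed := tp_closed par_ok.
Let Dr := tp_potential_root par_ok.
Let D_le := tp_potential par_ok.
Let par_root := tp_parent_root par_ok.
Let par_tight := tp_parent par_ok.
Let par_acyclic := tp_acyclic par_ok.

Definition parent_tree : {set W * W} :=
  [set d | [&& S d.2, d.2 != r & d.1 == par d.2]].

Lemma path_S x p : S x -> path adj x p -> S (last x p).
Proof.
by elim: p x => //= y p IHp x Sx /andP[/(S_closed Sx)/IHp]; apply.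
Qed.

(** In a finite type the orbit of [z] under [par] must loop, and acyclicity allows a loop only at
    [r]. *)
Lemma iter_par_root z : S z -> exists n, iter n par z = r.
Proof.
move=> Sz; have /trajectP[i lt_i eq_i] := looping_order par z.
have S_iter n : S (iter n par z).
  elim: n => //= n IHn; have [->|nr] := eqVneq (iter n par z) r.
    by rewrite par_root.
  by have [] := par_tight IHn nr.
exists i; apply/eqP/negPn/negP => ir.
apply: (@par_acyclic (iter i par z) (order par z - i)) => //.
  by rewrite subn_gt0.
by rewrite -iterD subnK // ltnW.
Qed.

Lemma tree_dart x z :
  ((x, z) \in parent_tree) = [&& S z, z != r & x == par z].
Proof. by rewrite inE. Qed.

Lemma rel_of_tree x z :
  rel_of parent_tree x z = [&& S z, z != r & x == par z].
Proof. exact: tree_dart. Qed.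

Lemma tree_walk z : S z ->
  exists2 p, path (rel_of parent_tree) r p & last r p = z.
Proof.
move=> Sz; have [n] := iter_par_root Sz.
elim: n z Sz => [|n IHn] z Sz /=; first by move=> zr; exists [::].
rewrite -iterS iterSr; have [-> _|zr] := eqVneq z r; first by exists [::].
have [Sp adjp _] := par_tight Sz zr; case/(IHn _ Sp) => p rp lp.
exists (rcons p z); last by rewrite last_rcons.
by rewrite rcons_path rp lp rel_of_tree Sz zr eqxx.
Qed.

Lemma sub_tree_adj p x : path (rel_of parent_tree) x p -> path adj x p.
Proof.
apply: sub_path => y z; rewrite rel_of_tree => /and3P[Sz zr /eqP->].
by have [] := par_tight Sz zr.
Qed.

Lemma tree_walk_weight p :
  path (rel_of parent_tree) r p -> walk_weight w r p = D (last r p).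
Proof.
elim/last_ind: p => [|p z IHp]; first by rewrite walk_weight_nil.
rewrite rcons_path last_rcons walk_weight_rcons rel_of_tree.
case/andP=> /IHp -> /and3P[Sz zr /eqP lp].
by have [_ _ ->] := par_tight Sz zr; rewrite lp.
Qed.

Lemma potential_le p : path adj r p -> D (last r p) <= walk_weight w r p.
Proof.
elim/last_ind: p => [|p z IHp]; first by rewrite walk_weight_nil /= Dr.
rewrite rcons_path last_rcons walk_weight_rcons => /andP[rp pz].
by apply: le_trans (D_le (path_S Sr rp) pz) _; rewrite lerD2r IHp.
Qed.

Lemma tree_walk_shortest p :
  path (rel_of parent_tree) r p -> shortest adj w r p.
Proof.
move=> rp; split=> [|q rq lq]; first exact: sub_tree_adj.
by rewrite tree_walk_weight // -lq potential_le.
Qed.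

Lemma connect_tight_parents z : connect adj r z = S z.
Proof.
apply/connectP/idP => [[p rp ->]|/tree_walk[p rp <-]]; first exact: path_S.
by exists p => //; apply: sub_tree_adj.
Qed.

Lemma parent_tree_spt : is_spt adj w r parent_tree.
Proof.
split=> [[x z]|z|]; last exact: tree_walk_shortest.
- rewrite tree_dart => /and3P[Sz zr /eqP->] /=.
  have [Sp adjp _] := par_tight Sz zr; split=> //.
  by have [p rp <-] := tree_walk Sp; apply/connectP; exists p.
rewrite connect_tight_parents => /tree_walk[p rp lp]; exists p; split=> // q [rq lq].
(* The two tree walks are compared from their common end: [par] fixes the last dart, and no tree
   dart enters [r]. *)
have: last r p = last r q by rewrite lp lq.
elim/last_ind: p q rp rq {lp lq} => [|p x IHp] q.
  case/lastP: q => // q x _; rewrite rcons_path last_rcons rel_of_tree.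
  by move=> /and4P[_ _ /negP xr _] rx; case: xr; rewrite -rx.
rewrite rcons_path last_rcons rel_of_tree => /and4P[rp Sx xr /eqP lp].
case/lastP: q => [_ xr'|q y]; first by rewrite xr' eqxx in xr.
rewrite rcons_path last_rcons rel_of_tree => /and4P[rq _ _ /eqP lq] xy.
by rewrite -xy in lq *; rewrite (IHp q) // lp lq.
Qed.

Hypothesis w_ge0 : forall x y, adj x y -> 0 <= w x y.

Lemma dist_potential z : S z -> dist adj w r z = D z.
Proof.
case/tree_walk=> p rp <-.
by rewrite shortest_dist // ?tree_walk_weight //; apply: tree_walk_shortest.
Qed.

(** The walks in [T] to [x] and to [z] are both shortest and differ by this dart. A dart into [r]
    would give [r] a second walk in [T] besides the empty one. *)
Lemma spt_dart_tight T x z : is_spt adj w r T -> (x, z) \in T ->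
  [/\ S x, adj x z, z != r & D z = D x + w x z].
Proof.
case=> T_adj T_uniq T_short xzT; have [/= xz cx] := T_adj _ xzT.
have [p rp lp] := connectP cx.
have rpz : path (rel_of T) r (rcons p z) by rewrite rcons_path rp -lp.
have sp := T_short _ rp; have spz := T_short _ rpz.
have Sx : S x by rewrite lp; apply: path_S; case: sp.
have Sz : S z by apply: S_closed xz.
split=> //.
  apply/eqP=> zr; have [q [_ uq]] := T_uniq z ltac:(by rewrite connect_tight_parents).
  have e1 := uq [::] ltac:(by split).
  have e2 := uq (rcons p z) ltac:(by rewrite last_rcons).
  by move: e2; rewrite e1; case: p {lp rp rpz sp spz}.
rewrite -!dist_potential // {1}lp (shortest_dist w_ge0 sp).
have := shortest_dist w_ge0 spz; rewrite last_rcons => ->.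
by rewrite walk_weight_rcons -lp.
Qed.

Lemma spt_dart_exists T z : is_spt adj w r T -> S z -> z != r ->
  exists x, (x, z) \in T.
Proof.
case=> T_adj T_uniq T_short Sz zr.
have [p [[rp lp] _]] := T_uniq z ltac:(by rewrite connect_tight_parents).
case/lastP: p rp lp => [_ /= rz|p y]; first by rewrite rz eqxx in zr.
rewrite rcons_path last_rcons => /andP[_ py] yz.
by exists (last r p); rewrite -yz.
Qed.

End TightTree.

(** * Crossing positions and the vertices reached through one end of the edge *)

Section Crossing.
Variables (R : realType) (V : finType) (adj : rel V) (w : V -> V -> R).

(* The position of s up to which z is reached through u, and after which it is
   reached through v. *)
Definition crossing u v z : R :=
  (w u v + dist adj w v z - dist adj w u z) / (w v u + w u v).

(* The point s itself is [None].  The dart u -> v of G does not survive in the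
   subdivision, so a vertex whose tight predecessor it provides gets s. *)
Definition sub_parent u v z : option V :=
  [pick x | sub_adj adj u v (Some x) (Some z) && tight_pred adj w u x z].

(** Closed form for the distance from [s], used as the potential in [tight_parents]; [dist_atE]
    justifies it on reachable vertices. *)
Definition sub_dist u v l (x : option V) : R :=
  if x is Some z then
    Num.min (l * w v u + dist adj w u z) ((1 - l) * w u v + dist adj w v z)
  else 0.

(** Exchanging [u] and [v] while sending [l] to [1 - l] is a symmetry of the subdivision. It
    transfers facts about the side of [u] to the side of [v]. *)
Lemma sub_adjC u v : sub_adj adj u v =2 sub_adj adj v u.
Proof. by case=> [x|] [y|] //=; rewrite !inE orbC. Qed.

Lemma sub_wC u v l x y : u != v -> sub_adj adj u v x y ->
  sub_w w v u (1 - l) x y = sub_w w u v l x y.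
Proof.
have e : 1 - (1 - l) = l by ring.
move=> uv; have vu : v != u by rewrite eq_sym.
case: x y => [x|] [y|] //=; rewrite !inE => /orP[] /eqP->;
  by rewrite ?eqxx ?(negbTE uv) ?(negbTE vu) ?e.
Qed.

Lemma sub_distC u v l x : sub_dist v u (1 - l) x = sub_dist u v l x.
Proof.
case: x => //= z; rewrite minC; congr (Num.min (_ * _ + _) _); ring.
Qed.

Hypothesis adj_sym : symmetric adj.
Hypothesis w_ge0 : forall x y, adj x y -> 0 <= w x y.
Hypothesis w_unique : unique_shortest_paths adj w.

Section OneSide.
Variables u v : V.
Hypotheses (adj_uv : adj u v) (u_neq_v : u != v).

Let adj_vu : adj v u. Proof. by rewrite adj_sym. Qed.

Lemma connect_end z : connect adj v z = connect adj u z.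
Proof.
have cuv := connect1 adj_uv; have cvu := connect1 adj_vu.
by apply/idP/idP => cz;
  [apply: connect_trans cuv _ | apply: connect_trans cvu _].
Qed.

Lemma edge_weight_gt0 : 0 < w v u + w u v.
Proof.
apply: lt_le_trans (dist_cycle_gt0 w_ge0 w_unique adj_uv (connect1 adj_vu)) _.
rewrite addrC lerD2r; have := dist_step w_ge0 (connect0 adj v) adj_vu.
by rewrite dist_refl // add0r.
Qed.

Lemma dist_end z : connect adj u z ->
  dist adj w u z <= w u v + dist adj w v z.
Proof. by move=> cz; apply: dist_head => //; rewrite connect_end. Qed.

Lemma le_crossing l z : (l <= crossing u v z) =
  (l * w v u + dist adj w u z <= (1 - l) * w u v + dist adj w v z).
Proof.
rewrite /crossing ler_pdivlMr ?edge_weight_gt0 //.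
by apply/idP/idP => h; lra.
Qed.

Lemma ge_crossing l z : (crossing u v z <= l) =
  ((1 - l) * w u v + dist adj w v z <= l * w v u + dist adj w u z).
Proof.
rewrite /crossing ler_pdivrMr ?edge_weight_gt0 //.
by apply/idP/idP => h; lra.
Qed.

Lemma crossing_ge0 z : connect adj u z -> 0 <= crossing u v z.
Proof. by move=> /dist_end ?; rewrite le_crossing; lra. Qed.

Lemma crossingC z : crossing v u z = 1 - crossing u v z.
Proof.
have := edge_weight_gt0; rewrite /crossing => /gt_eqF/negbT h.
by field.
Qed.

(** Red means reached through [u], blue means reached through [v]; at its crossing a vertex may
    count as either. *)
Lemma sub_dist_red l z : l <= crossing u v z ->
  sub_dist u v l (Some z) = l * w v u + dist adj w u z.
Proof. by rewrite le_crossing /= => h; rewrite min_l. Qed.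

Lemma sub_parent_some z x : sub_parent u v z = Some x <->
  sub_adj adj u v (Some x) (Some z) /\ tight_pred adj w u x z.
Proof.
rewrite /sub_parent; case: pickP => [y /andP[ay ty]|none].
  split=> [[<-] //|[_ tx]]; congr Some.
  exact: (tight_pred_uniq w_ge0 w_unique ty tx).
by split=> // -[ax tx]; have := none x; rewrite ax tx.
Qed.

(** For [z] other than [u] the search fails only if the tight dart into [z] is the subdivided dart
    from [u] to [v]. Then that dart realises the distance from [u] to [v], which puts the crossing
    of [v] at 0. *)
Lemma sub_parent_none z : connect adj u z -> sub_parent u v z = None ->
  z = u \/ z = v /\ crossing u v v = 0.
Proof.
move=> cz; rewrite /sub_parent; case: pickP => // none _.
have [->|zu] := eqVneq z u; [by left | right].
have [x tx] := tight_pred_exists w_ge0 cz zu.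
have := none x; rewrite tx andbT; case/and3P: tx => _ xz /eqP dz.
rewrite /= xz /= !inE /= => /negPn/orP[] /eqP[? ?]; subst.
- by split=> //; rewrite /crossing dz !dist_refl // add0r addr0 subrr mul0r.
- by rewrite eqxx in zu.
Qed.

Lemma sub_parent_self : sub_parent u v u = None.
Proof.
by rewrite /sub_parent; case: pickP => // x; rewrite tight_pred_root ?andbF.
Qed.

Lemma sub_parent_end : crossing u v v = 0 -> sub_parent u v v = None.
Proof.
move=> c0; case e: (sub_parent u v v) => [x|] //.
have [ax tx] := (sub_parent_some _ _).1 e.
have ge0 : 0 <= crossing u v v by rewrite c0.
have le0 : crossing u v v <= 0 by rewrite c0.
have tu : tight_pred adj w u u v.
  rewrite /tight_pred connect0 adj_uv dist_refl // add0r /=.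
  move: ge0 le0; rewrite le_crossing ge_crossing dist_refl // => ? ?.
  by apply/eqP; lra.
move: ax; rewrite (tight_pred_uniq w_ge0 w_unique tx tu) /=.
by rewrite inE eqxx andbF.
Qed.

(** The dart is tight from [u], while from [v] it only satisfies the triangle inequality; hence the
    difference of the two distances can only drop from [x] to [z]. *)
Lemma crossing_parent z x : sub_parent u v z = Some x ->
  connect adj u x /\ crossing u v z <= crossing u v x.
Proof.
move=> /sub_parent_some[_ /and3P[cx xz /eqP dz]]; split=> //.
have cvx : connect adj v x by rewrite connect_end.
have := dist_step w_ge0 cvx xz => dvz.
rewrite /crossing ler_pM2r ?invr_gt0 ?edge_weight_gt0 // dz.
by lra.
Qed.

(** Equal crossings turn the triangle inequality from [v] into an equality, so the same dart is
    tight from both ends. *)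
Lemma crossing_parent_eq z x : sub_parent u v z = Some x ->
  crossing u v z = crossing u v x -> sub_parent v u z = Some x.
Proof.
move=> /[dup] /sub_parent_some[ax /and3P[cx xz /eqP dz]] _.
move/(mulIf (invr_neq0 (lt0r_neq0 edge_weight_gt0))) => cz.
have tx : tight_pred adj w v x z.
  by apply/and3P; split; rewrite ?connect_end //; apply/eqP; lra.
rewrite /sub_parent; case: pickP => [y /andP[_ ty]|/(_ x)].
  by congr Some; exact: (tight_pred_uniq w_ge0 w_unique ty tx).
by rewrite sub_adjC ax tx.
Qed.

(** By [crossing_parent] the parent is red whenever [z] is, so both distances follow the branch
    through [u]. *)
Lemma sub_parent_tight l z : connect adj u z -> 0 <= l <= crossing u v z ->
  sub_adj adj u v (sub_parent u v z) (Some z) /\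
  sub_dist u v l (Some z) =
    sub_dist u v l (sub_parent u v z) +
      sub_w w u v l (sub_parent u v z) (Some z).
Proof.
move=> cz /andP[l0 lz]; rewrite (sub_dist_red lz).
case e: (sub_parent u v z) => [x|].
  have [cx zx] := crossing_parent e.
  have [ax /and3P[_ xz /eqP ->]] := (sub_parent_some _ _).1 e.
  by rewrite sub_dist_red ?(le_trans lz) //= addrA.
have [zu|[zv c0]] := sub_parent_none cz e; subst z.
  by rewrite /= inE !eqxx dist_refl // add0r addr0.
rewrite /= !inE eqxx orbT [v == u]eq_sym (negbTE u_neq_v).
(* The parent [s] of [v] is legitimate only at [l = 0], where [s] stands for [u] and its dart to [v]
   has the full weight. *)
have l_eq0 : l = 0 by apply/eqP; rewrite eq_le l0 andbT -c0.
split=> //; rewrite l_eq0.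
have ge0 : 0 <= crossing u v v by rewrite c0.
have le0 : crossing u v v <= 0 by rewrite c0.
by move: ge0 le0; rewrite le_crossing ge_crossing dist_refl // => ? ?; lra.
Qed.

(** The branch of [z] through [u] is squeezed: the minimum bounds it from below, the triangle
    inequality from above, and tightness makes these bounds equal. *)
Lemma red_tight l x z :
  connect adj u x -> sub_adj adj u v (Some x) (Some z) ->
  l <= crossing u v x ->
  sub_dist u v l (Some z) = sub_dist u v l (Some x) + w x z ->
  Some x = sub_parent u v z /\ l <= crossing u v z.
Proof.
move=> cx axz lx; have xz : adj x z by case/andP: axz.
rewrite (sub_dist_red lx) => dz.
have du := dist_step w_ge0 cx xz.
have le_u : sub_dist u v l (Some z) <= l * w v u + dist adj w u z.
  by rewrite /= ge_min lexx.
have le_v : sub_dist u v l (Some z) <= (1 - l) * w u v + dist adj w v z.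
  by rewrite /= ge_min lexx orbT.
have dz' : dist adj w u z = dist adj w u x + w x z by lra.
split; last by rewrite le_crossing; lra.
apply/esym/sub_parent_some; split=> //.
by rewrite /tight_pred cx xz dz' /=.
Qed.

Lemma red_tight_source l :
  sub_dist u v l (Some u) = sub_w w u v l None (Some u) ->
  None = sub_parent u v u /\ l <= crossing u v u.
Proof.
rewrite sub_parent_self /= eqxx => du; split=> //; rewrite le_crossing.
by rewrite dist_refl // addr0 -du ge_min lexx orbT.
Qed.

End OneSide.
End Crossing.

(** * Two auxiliary facts on finite types *)

Lemma gap_exists (R : realType) (V : finType) (b : R) (f : V -> R) : 0 < b ->
  exists2 eps, 0 < eps <= b & forall y, f y != 0 -> eps <= `|f y|.
Proof.
move=> b0; suff [eps eps0 h] : exists2 eps, 0 < eps <= b &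
    forall y, y \in enum V -> f y != 0 -> eps <= `|f y|.
  by exists eps => // y; apply: h; rewrite mem_enum.
elim: (enum V) => [|x s [eps /andP[eps0 epsb] h]].
  by exists b; rewrite ?b0 ?lexx.
have [fx|fx] := eqVneq (f x) 0.
  exists eps; rewrite ?eps0 // => y; rewrite inE => /predU1P[->|/h //].
  by rewrite fx eqxx.
exists (Num.min eps `|f x|).
  by rewrite lt_min eps0 normr_gt0 fx ge_min epsb.
move=> y; rewrite inE ge_min => /predU1P[-> _|ys fy].
  by rewrite lexx orbT.
by rewrite h.
Qed.

Lemma card_eq_finset (T : finType) (N : {set T}) :
  ([set` N]%classic #= `I_#|N|)%card.
Proof.
have -> : [set` N]%classic = [set` [fset x in enum N]%fset]%classic.
  by apply/seteqP; split=> x /=; rewrite !inE mem_enum.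
by apply/card_eq_fsetP; rewrite card_fseq undup_id ?enum_uniq // -cardE.
Qed.

(** * Tight darts and shortest-path trees at a position of [s] *)

Section Sweep.
Variables (R : realType) (V : finType) (adj : rel V) (w : V -> V -> R).
Variables u v : V.
Hypothesis adj_sym : symmetric adj.
Hypothesis w_ge0 : forall x y, adj x y -> 0 <= w x y.
Hypothesis w_unique : unique_shortest_paths adj w.
Hypotheses (adj_uv : adj u v) (u_neq_v : u != v).

Let adj_vu : adj v u. Proof. by rewrite adj_sym. Qed.
Let v_neq_u : v != u. Proof. by rewrite eq_sym. Qed.

Local Notation c := (crossing adj w u v).
Local Notation p0 := (sub_parent adj w u v).
Local Notation p1 := (sub_parent adj w v u).
Local Notation sadj := (sub_adj adj u v).
Local Notation sw := (sub_w w u v).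
Local Notation sd := (sub_dist adj w u v).

Let crossC z : crossing adj w v u z = 1 - c z :=
  crossingC adj_sym w_ge0 w_unique adj_uv z.
Let connect_v z : connect adj v z = connect adj u z :=
  connect_end adj_sym adj_uv z.

Lemma crossing_le1 z : connect adj u z -> c z <= 1.
Proof.
rewrite -connect_v => /(crossing_ge0 adj_sym w_ge0 w_unique adj_vu).
by rewrite crossC subr_ge0.
Qed.

Lemma sub_dist_blue l z : c z <= l ->
  sd l (Some z) = (1 - l) * w u v + dist adj w v z.
Proof.
move=> lz; rewrite -sub_distC.
by rewrite (sub_dist_red adj_sym w_ge0 w_unique adj_vu) // crossC; lra.
Qed.

Lemma crossing_parent1 z x : p1 z = Some x -> connect adj u x /\ c x <= c z.
Proof.
case/(crossing_parent adj_sym w_ge0 w_unique adj_vu).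
by rewrite connect_v !crossC => -> ?; split=> //; lra.
Qed.

Lemma crossing_parent1_eq z x : p1 z = Some x -> c z = c x -> p0 z = Some x.
Proof.
move=> pz cz; apply: (crossing_parent_eq adj_sym w_ge0 w_unique adj_vu pz).
by rewrite !crossC cz.
Qed.

(** A parent [x] of [z] on the side of [v] satisfies [0 <= c x <= c z = 0], so the crossings agree
    and [x] is also the parent from [u]. Thus no parent changes at the start of the sweep. *)
Lemma sub_parent_crossing0 z : connect adj u z -> c z = 0 -> p0 z = p1 z.
Proof.
move=> cz z0; case e: (p1 z) => [x|].
  have [cx xz] := crossing_parent1 e; apply: crossing_parent1_eq e _.
  have cx0 := crossing_ge0 adj_sym w_ge0 w_unique adj_uv cx.
  by apply/eqP; rewrite eq_le xz z0 cx0.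
have czv : connect adj v z by rewrite connect_v.
have [zv|[zu u1]] := sub_parent_none w_ge0 czv e; subst z.
  exact: (sub_parent_end adj_sym w_ge0 w_unique adj_uv).
by move: u1; rewrite crossC z0 subr0 => /eqP; rewrite oner_eq0.
Qed.

Lemma sub_parent_edge l z x : 0 <= l <= 1 -> connect adj u z ->
  x = p0 z /\ l <= c z \/ x = p1 z /\ c z <= l ->
  sadj x (Some z) /\ sd l (Some z) = sd l x + sw l x (Some z).
Proof.
case/andP=> l0 l1 cz [[-> lz]|[-> lz]].
  by apply: sub_parent_tight => //; rewrite l0.
have czv : connect adj v z by rewrite connect_v.
have l01 : 0 <= 1 - l <= crossing adj w v u z by rewrite crossC; lra.
have := sub_parent_tight adj_sym w_ge0 w_unique adj_vu v_neq_u czv l01.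
rewrite !sub_distC sub_adjC => -[az ->]; split=> //.
by rewrite (@sub_wC _ _ adj).
Qed.

(** The tail is red or blue at [l]; [red_tight] settles the first case and its mirror image the
    second. A dart out of [s] goes to [u] or to [v], again mirror cases. *)
Lemma sub_edge_parent l z x : 0 <= l <= 1 -> connect adj u z ->
  sadj x (Some z) -> sd l (Some z) = sd l x + sw l x (Some z) ->
  x = p0 z /\ l <= c z \/ x = p1 z /\ c z <= l.
Proof.
move=> /andP[l0 l1] cz axz dz; have avxz := axz; rewrite sub_adjC in avxz.
have dz' : sub_dist adj w v u (1 - l) (Some z) =
    sub_dist adj w v u (1 - l) x + sub_w w v u (1 - l) x (Some z).
  by rewrite !sub_distC (@sub_wC _ _ adj).
have flip : 1 - l <= crossing adj w v u z -> c z <= l.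
  by rewrite crossC => ?; lra.
case: x axz dz avxz dz' => [x|] axz dz avxz dz'.
  have cx : connect adj u x.
    case/andP: axz => xz _; apply: connect_trans cz (connect1 _).
    by rewrite adj_sym.
  have [lx|/ltW xl] := leP l (c x).
    by left; apply: (red_tight adj_sym w_ge0 w_unique adj_uv cx axz lx dz).
  right; have cvx : connect adj v x by rewrite connect_v.
  have lx' : 1 - l <= crossing adj w v u x by rewrite crossC; lra.
  have [-> h] := red_tight adj_sym w_ge0 w_unique adj_vu cvx avxz lx' dz'.
  by split=> //; apply: flip.
move: axz; rewrite /= !inE => /orP[] /eqP zE; subst z.
  left; apply: (red_tight_source adj_sym w_ge0 w_unique adj_uv).
  by rewrite dz /= add0r.
right; have [|h1 /flip h2] // :=
  red_tight_source adj_sym w_ge0 w_unique adj_vu (l := 1 - l).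
by rewrite dz' /= add0r.
Qed.

Definition sub_reach (x : option V) :=
  if x is Some z then connect adj u z else true.

Definition sweep_parent (red : pred V) (x : option V) : option V :=
  if x is Some z then if red z then p0 z else p1 z else None.

Definition sweep_tree (red : pred V) :=
  parent_tree None sub_reach (sweep_parent red).

(** Either colour is allowed when [l = c z]; this lets the trees before and after a pivot both be
    valid at the pivot itself. *)
Definition sweep_split (l : R) (red : pred V) :=
  forall z, connect adj u z -> if red z then l <= c z else c z <= l.

Lemma sub_w_ge0 l x y : 0 <= l <= 1 -> sadj x y -> 0 <= sw l x y.
Proof.
case/andP=> l0 l1; have := w_ge0 adj_uv; have := w_ge0 adj_vu => h1 h2.
have l1' : 0 <= 1 - l by rewrite subr_ge0.
case: x y => [x|] [y|] //=; first by case/andP=> /w_ge0.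
all: by move=> _; case: ifP => _; apply: mulr_ge0.
Qed.

Lemma sub_reach_closed x z : sub_reach x -> sadj x z -> sub_reach z.
Proof.
case: x z => [x|] [z|] //=.
  by move=> cx /andP[xz _]; apply: connect_trans cx (connect1 xz).
rewrite !inE => _ /orP[] /eqP-> //; exact: connect1.
Qed.

Lemma sub_dist_step l x z : 0 <= l <= 1 -> sub_reach x -> sadj x z ->
  sd l z <= sd l x + sw l x z.
Proof.
move=> l01; case: x z => [x|] [z|] // cx; last first.
- move=> xz; have := sub_w_ge0 l01 xz; case/andP: l01 => l0 l1 w0 /=.
  rewrite add0r; move: xz w0; rewrite /= !inE => /orP[] /eqP-> _.
    by rewrite eqxx dist_refl // addr0 ge_min lexx.
  by rewrite (negbTE v_neq_u) dist_refl // addr0 ge_min lexx orbT.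
- move=> xz; rewrite addr_ge0 ?sub_w_ge0 //; case/andP: l01 => l0 l1.
  by rewrite /= le_min !addr_ge0 ?mulr_ge0 ?dist_ge0 ?w_ge0 ?subr_ge0.
rewrite /= => /andP[xz _].
have h1 := dist_step w_ge0 cx xz.
have cvx : connect adj v x by rewrite connect_v.
have h2 := dist_step w_ge0 cvx xz.
rewrite addr_minl le_min !ge_min -!addrA !lerD2l h1 h2 orbT //.
Qed.

Section Tree.
Variables (l : R) (red : pred V).
Hypotheses (l01 : 0 <= l <= 1) (red_l : sweep_split l red).

Lemma sweep_parent_tight z : connect adj u z ->
  [/\ sub_reach (sweep_parent red (Some z)),
      sadj (sweep_parent red (Some z)) (Some z)
    & sd l (Some z) = sd l (sweep_parent red (Some z)) +
        sw l (sweep_parent red (Some z)) (Some z)].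
Proof.
move=> cz; have tight : sweep_parent red (Some z) = p0 z /\ l <= c z \/
    sweep_parent red (Some z) = p1 z /\ c z <= l.
  by have := red_l cz; rewrite /=; case: ifP => _ ?; [left|right].
have [az dz] := sub_parent_edge l01 cz tight.
split=> //; case e: (sweep_parent red (Some z)) az => [x|] //= /andP[xz _].
by apply: connect_trans cz (connect1 _); rewrite adj_sym.
Qed.

(** This gives acyclicity: a chain of parents that has not reached [s] is a reversed walk of G, with
    weight equal to the drop in [sd]. If it returned to [z], it would be a closed walk of weight
    0. *)
Lemma sweep_iter n z y : connect adj u z ->
  iter n (sweep_parent red) (Some z) = Some y ->
  connect adj u y /\ exists q, [/\ path adj y q, last y q = z, size q = n
    & sd l (Some z) = sd l (Some y) + walk_weight w y q].
Proof.
move=> cz; elim: n y => [|n IHn] y; rewrite ?iterS.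
  by case=> <-; split=> //; exists [::]; rewrite walk_weight_nil addr0.
case: (iter n (sweep_parent red) (Some z)) IHn => [x|] // /(_ x erefl).
case=> cx [q [xq lq szq dz]] px; have [sy] := sweep_parent_tight cx.
rewrite px in sy * => /andP[yx _] dx; split=> //; exists (x :: q).
split=> //; [by rewrite /= yx | by rewrite /= szq |].
by rewrite dz dx walk_weight_cons addrA.
Qed.

Lemma sweep_parents :
  tight_parents sadj (sw l) None sub_reach (sd l) (sweep_parent red).
Proof.
split=> //.
- exact: sub_reach_closed.
- by move=> x z; apply: sub_dist_step.
- by case=> // z cz _; apply: sweep_parent_tight.
case=> // z n cz _ n_gt0 /(sweep_iter cz)[_ [q [zq lq szq dz]]].
have w0 : walk_weight w z q = 0 by move: dz; lra.
by have q0 := closed_walk_eq0 w_ge0 w_unique zq lq w0; rewrite -szq q0 in n_gt0.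
Qed.

Lemma sweep_tree_spt : spt_at adj w u v l (sweep_tree red).
Proof. exact: parent_tree_spt sweep_parents. Qed.

End Tree.

Lemma sweep_splitP l : sweep_split l (fun z => l <= c z).
Proof. by move=> z _ /=; case: leP => // /ltW. Qed.

Lemma dist_atE l x : 0 <= l <= 1 -> sub_reach x ->
  dist_at adj w u v l x = sd l x.
Proof.
move=> l01; apply: (dist_potential (sweep_parents l01 (@sweep_splitP l))).
by move=> *; apply: sub_w_ge0.
Qed.

Lemma dist_at_unreachable l z : 0 <= l <= 1 -> ~~ connect adj u z ->
  dist_at adj w u v l (Some z) = 0.
Proof.
move=> l01 uNz; apply: dist_unreachable.
by rewrite (connect_tight_parents (sweep_parents l01 (@sweep_splitP l))).
Qed.

Lemma sub_adj_reach x z : sadj x (Some z) -> connect adj u z -> sub_reach x.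
Proof.
case: x => //= x /andP[xz _] cz.
by apply: connect_trans cz (connect1 _); rewrite adj_sym.
Qed.

Lemma slackE l x z : 0 <= l <= 1 -> connect adj u z -> sadj x (Some z) ->
  slack adj w u v l (x, Some z) = sd l x + sw l x (Some z) - sd l (Some z).
Proof.
by move=> l01 cz axz; rewrite /slack !dist_atE //=; apply: sub_adj_reach axz cz.
Qed.

Lemma slack_eq0 l x z : 0 <= l <= 1 -> connect adj u z -> sadj x (Some z) ->
  slack adj w u v l (x, Some z) = 0 <->
  x = p0 z /\ l <= c z \/ x = p1 z /\ c z <= l.
Proof.
move=> l01 cz axz; rewrite slackE //.
split=> [s0|/(sub_parent_edge l01 cz)[_ ->]].
  by apply: sub_edge_parent => //; lra.
by rewrite subrr.
Qed.

Lemma spt_at_dart l T x y : 0 <= l <= 1 -> spt_at adj w u v l T ->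
  (x, y) \in T -> exists z, [/\ y = Some z, connect adj u z &
    x = p0 z /\ l <= c z \/ x = p1 z /\ c z <= l].
Proof.
move=> l01 sptT xyT.
have sw0 a b : sadj a b -> 0 <= sw l a b by apply: sub_w_ge0.
have [rx axy y0 dy] :=
  spt_dart_tight (sweep_parents l01 (@sweep_splitP l)) sw0 sptT xyT.
case: y axy y0 dy {xyT} => // z axz _ dz; exists z.
have cz := sub_reach_closed rx axz; split=> //.
exact: sub_edge_parent.
Qed.

(* The agreement hypothesis holds at l = 0 and l = 1 by [sub_parent_crossing0]
   and its mirror image. *)
Lemma spt_at_unique l T red : 0 <= l <= 1 -> sweep_split l red ->
  (forall z, connect adj u z -> c z = l -> p0 z = p1 z) ->
  spt_at adj w u v l T -> T = sweep_tree red.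
Proof.
move=> l01 red_l agree sptT.
have sub x y : (x, y) \in T -> (x, y) \in sweep_tree red.
  case/(spt_at_dart l01 sptT) => z [-> cz xz].
  rewrite /sweep_tree tree_dart /= cz /=; apply/eqP.
  have := red_l _ cz; case: ifP => _ lz; case: xz => -[-> zl] //.
    by rewrite agree //; apply/le_anti/andP.
  by rewrite agree //; apply/le_anti/andP.
apply/setP=> -[x y]; apply/idP/idP => [/sub //|].
rewrite /sweep_tree tree_dart => /and3P[ry yN /eqP xE].
have [x' x'T] := spt_dart_exists (sweep_parents l01 red_l) sptT ry yN.
have := sub _ _ x'T; rewrite /sweep_tree tree_dart => /and3P[_ _ /eqP x'E].
by rewrite xE -x'E.
Qed.

(** * Vertices that change parent, and the darts that become tense *)

Definition swapped z := connect adj u z && (p0 z != p1 z).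

Lemma swapped_crossing z : swapped z -> 0 < c z <= 1.
Proof.
case/andP=> cz pz; rewrite crossing_le1 // andbT lt_def.
rewrite (crossing_ge0 adj_sym w_ge0 w_unique adj_uv cz) andbT.
by apply: contra pz => /eqP/(sub_parent_crossing0 cz)->.
Qed.

Lemma swapped_crossing01 z : swapped z -> 0 <= c z <= 1.
Proof. by case/swapped_crossing/andP=> /ltW-> ->. Qed.

(** The slack vanishes at [l] but not just before. Among the darts tight at [l], this leaves only
    one from [p1 z] with [c z = l], and it excludes [p0 z = p1 z]. *)
Lemma becomes_tense_swapped l d : becomes_tense adj w u v l d ->
  exists z, [/\ swapped z, c z = l & d = (p1 z, Some z)].
Proof.
case: d => x [z|] [l1 /= axz // _ [eps [/andP[eps0 epsl] _ decr s0]]].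
have l01 : 0 <= l <= 1 by rewrite l1; lra.
have pos a : l - eps <= a < l -> slack adj w u v a (x, Some z) != 0.
  by case/andP=> la al; rewrite gt_eqF // -s0 decr.
have cz : connect adj u z.
  apply/negPn/negP => cz.
  case: x axz decr s0 pos => [x|] axz decr s0 pos; last first.
    by case/negP: cz; apply: (sub_reach_closed (x := None)) axz.
  have cx : ~~ connect adj u x.
    by apply: contra cz => cx; apply: (sub_reach_closed (x := Some x)) axz.
  (* With both ends unreachable, both distances take the default value 0 and the slack is
     constant. *)
  have e01 : 0 <= l - eps <= 1 by lra.
  have := pos (l - eps); rewrite -s0 /slack !dist_at_unreachable //=.
  by rewrite eqxx lexx => /(_ _)/negP; apply; lra.
exists z; have pos' a : l - eps <= a < l ->
    ~ (x = p0 z /\ a <= c z \/ x = p1 z /\ c z <= a).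
  move=> ha tight; have a01 : 0 <= a <= 1 by lra.
  by have /eqP := pos _ ha; apply; apply/(slack_eq0 a01 cz axz).
have hl : l - eps <= l - eps < l by lra.
have [[xp lz]|[xp zl]] := (slack_eq0 l01 cz axz).1 s0.
  by case: (pos' _ hl); left; split=> //; lra.
have czl : c z = l.
  apply: le_anti; rewrite zl /= leNgt; apply/negP => zl'.
  (* If [c z < l], the dart would already be tight at this point of the window before [l]. *)
  pose a := Num.max (c z) (l - eps); apply: (pos' a); last first.
    by right; rewrite le_max lexx.
  by rewrite le_max lexx orbT gt_max zl' /=; lra.
split=> //; last by rewrite xp.
rewrite /swapped cz; apply/eqP => p01; apply: (pos' _ hl).
by left; rewrite p01 czl; split=> //; lra.
Qed.

(** Between the crossing of the new parent and that of [z], the parent is blue and [z] still red, so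
    the slack is affine. Equal crossings would force [p0 z = p1 z]; if the parent is [s], the
    interval starts at 0. *)
Lemma swapped_slack z : swapped z -> exists lo K : R, 0 <= lo < c z /\
  forall t, lo <= t <= c z ->
    slack adj w u v t (p1 z, Some z) = K - t * (w v u + w u v).
Proof.
move=> /[dup] sz /andP[cz pz]; have /andP[z0 z1] := swapped_crossing sz.
have [az _] := sub_parent_edge (swapped_crossing01 sz) cz
  (or_intror (conj erefl (lexx (c z)))).
case e: (p1 z) az => [x|] az.
  have [cx xz] := crossing_parent1 e.
  exists (c x), (w u v + dist adj w v x + w x z - dist adj w u z).
  split.
    rewrite (crossing_ge0 adj_sym w_ge0 w_unique adj_uv cx) lt_neqAle xz andbT.
    by apply: contra pz => /eqP /esym/(crossing_parent1_eq e)->; rewrite e.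
  move=> t /andP[xt tz]; rewrite slackE //; last first.
    by have := crossing_ge0 adj_sym w_ge0 w_unique adj_uv cx; lra.
  rewrite (sub_dist_blue xt) (sub_dist_red adj_sym w_ge0 w_unique adj_uv tz) /=.
  by ring.
have czv : connect adj v z by rewrite connect_v.
have [zv|[zu u1]] := sub_parent_none w_ge0 czv e; subst z.
  exists 0, (w u v - dist adj w u v); split; first by rewrite lexx.
  move=> t /andP[t0 tz]; rewrite slackE //; last by lra.
  rewrite (sub_dist_red adj_sym w_ge0 w_unique adj_uv tz) /=.
  by rewrite (negbTE v_neq_u); ring.
(* For [z = u] both parents are [s], so [u] would not be swapped. *)
by rewrite (sub_parent_self w_ge0 w_unique) e eqxx in pz.
Qed.

Lemma swapped_becomes_tense z : swapped z ->
  becomes_tense adj w u v (c z) (p1 z, Some z).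
Proof.
move=> sz; have /andP[z0 z1] := swapped_crossing sz.
have [cz _] := andP sz; have [lo [K [/andP[lo0 loz] slE]]] := swapped_slack sz.
have z01 := swapped_crossing01 sz.
have blue : p1 z = p0 z /\ c z <= c z \/ p1 z = p1 z /\ c z <= c z by right.
have [az _] := sub_parent_edge z01 cz blue.
have gt0 := edge_weight_gt0 adj_sym w_ge0 w_unique adj_uv.
have s0 : slack adj w u v (c z) (p1 z, Some z) = 0 by apply/slack_eq0.
have decr a b : c z - (c z - lo) <= a -> a < b -> b <= c z ->
    slack adj w u v b (p1 z, Some z) < slack adj w u v a (p1 z, Some z).
  move=> ha ab hb; rewrite !slE; try lra.
  by rewrite ltrD2l ltrN2 ltr_pM2r.
split=> //; exists (c z - lo); split=> //; first by lra.
move=> a T /andP[ha az'] sptT; apply/negP.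
have a01 : 0 <= a <= 1 by lra.
case/(spt_at_dart a01 sptT) => z' [[<-] _ tight].
have := decr a (c z) ha az' (lexx _).
by rewrite s0 ((slack_eq0 a01 cz az).2 tight) ltxx.
Qed.

(** * Pivots under genericity *)

Hypothesis tense_unique :
  forall l, critical adj w u v l -> exists! d, becomes_tense adj w u v l d.

Lemma swapped_crossing_inj z z' :
  swapped z -> swapped z' -> c z = c z' -> z = z'.
Proof.
move=> /swapped_becomes_tense t /swapped_becomes_tense t' zz'.
rewrite -zz' in t'; have [d [_ ud]] := tense_unique (ex_intro _ _ t).
by have := ud _ t; rewrite (ud _ t') => -[].
Qed.

Lemma swapped_pivot z : swapped z ->
  pivot adj w u v (c z) (p1 z, Some z) (p0 z, Some z).
Proof.
move=> sz; split; first exact: swapped_becomes_tense.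
have /andP[z0 z1] := swapped_crossing sz; have [cz pz] := andP sz.
(* [eps] is at most the distance from [c z] to any other crossing value, so no colour is forced to
   change elsewhere in the window. *)
have [eps /andP[eps0 epsz] gap] := gap_exists (fun y => c y - c z) z0.
exists eps, (sweep_tree (fun y => c z <= c y)); split.
- by rewrite eps0.
- by rewrite /sweep_tree tree_dart /= cz lexx eqxx.
- move=> a /andP[la al]; apply: sweep_tree_spt; first by lra.
  move=> y cy /=; case: leP => [|yz]; first exact: le_trans.
  have := gap y; rewrite subr_eq0 lt_eqF // => /(_ isT).
  by rewrite ltr0_norm ?subr_lt0 //; lra.
move=> a /andP[la al] a1.
suff -> : (p1 z, Some z) |: sweep_tree (fun y => c z <= c y) :\ (p0 z, Some z) =
    sweep_tree (fun y => c z < c y).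
  apply: sweep_tree_spt; first by lra.
  move=> y cy /=; case: ltP => [yz|]; last by move=> yz; apply: le_trans la.
  have := gap y; rewrite subr_eq0 gt_eqF // => /(_ isT).
  by rewrite gtr0_norm ?subr_gt0 //; lra.
apply/setP=> -[x y]; rewrite /sweep_tree !inE /= !xpair_eqE.
case: y => [y|]; last by rewrite /= !andbF.
have [->|yz] := eqVneq y z.
  rewrite /= eqxx !andbT lexx ltxx cz /=.
  by case: (x == p1 z) => //=; case: (x == p0 z).
have -> : (Some y == Some z) = false.
  by apply/eqP => -[] /eqP; rewrite (negbTE yz).
rewrite !andbF /=; case cy: (connect adj u y) => //=.
(* Another vertex with the same crossing also changes colour, but injectivity of the crossing on
   swapped vertices keeps its parent fixed. *)
rewrite le_eqVlt; case: (eqVneq (c z) (c y)) => //= czy; rewrite -czy ltxx.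
have -> // : p0 y = p1 y.
apply/eqP/negPn/negP => py; case/eqP: yz.
by apply/esym/swapped_crossing_inj => //; rewrite /swapped cy.
Qed.

(** The leaving dart is identified at the left end of the window, where [z] is strictly red and its
    parent can only be [p0 z]. *)
Lemma pivot_swapped l din dout : pivot adj w u v l din dout ->
  exists2 z, swapped z
    & (l, (din, dout)) = (c z, ((p1 z, Some z), (p0 z, Some z))).
Proof.
case=> /becomes_tense_swapped[z [sz <- ->]] [eps [T []]].
case/andP=> eps0 epsz; case: dout => x y [xyT /= yE] sptT _.
exists z => //; subst y.
have /andP[z0 z1] := swapped_crossing sz.
have a01 : 0 <= c z - eps <= 1 by lra.
have a_le : c z - eps <= c z - eps <= c z by lra.
have [z' [[<-] _ [[-> _] //|[_ zl]]]] := spt_at_dart a01 (sptT _ a_le) xyT.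
by exfalso; lra.
Qed.

End Sweep.

Theorem corollary3p3 (R : realType) (V : finType) (adj : rel V)
    (w : V -> V -> R) (u v : V)
    (adj_sym : symmetric adj)
    (w_ge0 : forall x y, adj x y -> 0 <= w x y)
    (adj_uv : adj u v) (u_neq_v : u != v)
    (w_generic : generic adj w u v)
    (Tu Tv : {set dart V})
    (spt_u : spt_at adj w u v 0 Tu) (spt_v : spt_at adj w u v 1 Tv) :
  (pivots adj w u v #= `I_#|Tu :\: Tv|)%card.
Proof.
case: w_generic => w_unique tense_unique.
have adj_vu : adj v u by rewrite adj_sym.
pose c := crossing adj w u v.
pose din z : dart V := (sub_parent adj w v u z, Some z).
pose dout z : dart V := (sub_parent adj w u v z, Some z).
pose N := [set z | swapped adj w u v z].
(* All crossings lie in [0, 1], so everything is red at 0 and blue at 1. *)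
have Tu_E : Tu = sweep_tree adj w u v predT.
  apply: (spt_at_unique adj_sym w_ge0 w_unique adj_uv u_neq_v _ _ _ spt_u).
  - by rewrite lexx ler01.
  - by move=> z cz /=; apply: crossing_ge0.
  - by move=> z; apply: sub_parent_crossing0.
have Tv_E : Tv = sweep_tree adj w u v pred0.
  apply: (spt_at_unique adj_sym w_ge0 w_unique adj_uv u_neq_v _ _ _ spt_v).
  - by rewrite lexx ler01.
  - by move=> z cz /=; apply: crossing_le1.
  move=> z cz z1; apply/esym.
  apply: (sub_parent_crossing0 adj_sym w_ge0 w_unique adj_vu).
    by rewrite (connect_end adj_sym adj_uv).
  by rewrite (crossingC adj_sym w_ge0 w_unique adj_uv) z1 subrr.
(* The dart of [Tu] into [z] is missing from [Tv] exactly when the two parents of [z] differ. *)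
have card_N : #|Tu :\: Tv| = #|N|.
  have <- : #|[set dout z | z in N]| = #|N| by apply: card_imset => y z [].
  apply: eq_card => -[x y]; rewrite Tu_E Tv_E !inE /=.
  apply/idP/imsetP => [|[z]].
    case: y => [z|]; last by rewrite andbF.
    case/andP=> /= pz /andP[cz /eqP xE]; move: pz; rewrite cz xE /= => pz.
    by exists z => //; rewrite inE /swapped cz pz.
  by rewrite inE => /andP[cz pz] [-> ->] /=; rewrite cz pz eqxx.
have -> : pivots adj w u v =
    ((fun z => (c z, (din z, dout z))) @` [set` N])%classic.
  apply/seteqP; split=> [[l [d d']] /= piv|_ [z + <-]].
    have [z sz e] := pivot_swapped adj_sym w_ge0 w_unique adj_uv u_neq_v piv.
    by exists z; rewrite /= ?inE.
  by rewrite /= inE => sz; apply: swapped_pivot.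
(* Distinct vertices give distinct pivots, since the vertex is the head of both darts. *)
apply: (card_eq_trans (inj_card_eq _)); first by move=> y z _ _ [].
by rewrite card_N; apply: card_eq_finset.
Qed.
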